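(* For every constant $C>0$ there is a constant $c>0$ depending only on $C$ such that the following holds. Let $\sigma>0$ and let $\mu_0,\mu_1,\mu_0',\mu_1'\in\mathbb{R}$ satisfy $\mu_0\le\min(\mu_1,\mu_0',\mu_1')$ and $\mu_0'\le\mu_1'$. Consider the one-dimensional mixtures $$f_{\mu_0,\mu_1}=\tfrac12\mathcal N(\mu_0,\sigma^2)+\tfrac12\mathcal N(\mu_1,\sigma^2),\qquad f_{\mu_0',\mu_1'}=\tfrac12\mathcal N(\mu_0',\sigma^2)+\tfrac12\mathcal N(\mu_1',\sigma^2),$$ and let $\delta_1=\max\{|\mu_0-\mu_1|,|\mu_0'-\mu_1'|\}$ and $\delta_2=\max\{|\mu_0'-\mu_0|,|\mu_1-\mu_1'|\}$. (i) If $[\mu_0',\mu_1']\subseteq[\mu_0,\mu_1]$ and $\sigma\ge C\delta_1$, then $$\|f_{\mu_0,\mu_1}-f_{\mu_0',\mu_1'}\|_{\mathsf{TV}}\ \ge\ c\,\min\Big(1,\frac{\delta_1\delta_2}{\sigma^2}\Big).$$ (ii) Otherwise (i.e. if at least one of the two conditions in (i) fails), $$\|f_{\mu_0,\mu_1}-f_{\mu_0',\mu_1'}\|_{\mathsf{TV}}\ \ge\ c\,\min\Big(1,\frac{\delta_2}{\sigma}\Big).$$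
   Context: $\mathcal N(\mu,\sigma^2)$ is the Gaussian distribution on $\mathbb{R}$ with mean $\mu$ and variance $\sigma^2$. The two mixtures share the same variance $\sigma^2$. The total variation distance between two distributions $f,f'$ on the same measurable space is $\|f-f'\|_{\mathsf{TV}}=\sup_{A}\,(f(A)-f'(A))$, the supremum being over all measurable sets $A$. *)

(* Defs.v *)
From HB Require Import structures.
From mathcomp Require Export all_boot all_order all_algebra.
From mathcomp Require Export all_classical all_reals all_analysis.

Set Implicit Arguments.
Unset Strict Implicit.
Unset Printing Implicit Defensive.

Import Order.TTheory GRing.Theory Num.Theory.

Local Open Scope classical_set_scope.
Local Open Scope ring_scope.

(* The supremum is taken in \bar R; it is finite since P and Q have mass 1. *)
Definition tv_dist (d : measure_display) (T : measurableType d) (R : realType)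
    (P Q : probability T R) : \bar R :=
  ereal_sup [set (P A - Q A)%E | A in [set A : set T | measurable A]].

Section half_mixture.
Context (d : measure_display) (T : measurableType d) (R : realType).
Variables P Q : probability T R.

Definition half_mixture : set T -> \bar R :=
  measure_add (mscale (2^-1 : R)%:nng P) (mscale (2^-1 : R)%:nng Q).

Lemma half_mixtureE (A : set T) :
  half_mixture A = ((2^-1)%:E * P A + (2^-1)%:E * Q A)%E.
Proof. exact: measure_addE. Qed.

HB.instance Definition _ := Measure.on half_mixture.

Let half_mixture_setT : half_mixture setT = 1%E.
Proof.
by rewrite half_mixtureE !probability_setT !mule1 -EFinD -[2^-1]div1r -splitr.
Qed.

HB.instance Definition _ :=
  Measure_isProbability.Build _ _ _ half_mixture half_mixture_setT.

End half_mixture.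

(* normal_prob takes the standard deviation, not the variance. *)
Definition normal_mixture (R : realType) (s m0 m1 : R) :
    probability (measurableTypeR R) R :=
  half_mixture (normal_prob m0 s) (normal_prob m1 s).

(* Main.v *)
(* Half-lines suffice as test sets.  With G the standard normal cdf, the masses
   that the two mixtures give to ]-oo, x] differ by half of
     (G ((x - m0) / s) - G ((x - m0') / s))
       - (G ((x - m1') / s) - G ((x - m1) / s)).
   If m1 < m1', both contributions are nonnegative, and x = m0 - s or x = m1 - s
   makes the larger one of order min(1, delta2 / s).  If the means are nested and
   m0' - m0 >= m1 - m1', take x = m0 - s: both brackets are then increments of G
   left of -1, where shifting by w to the left costs a factor expR (- w), so the
   second bracket is at most expR (- delta1 / (2 s)) times the first.  The
   remaining nested case is its mirror image, with x = m1 + s. *)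
Require Import Defs.
From mathcomp Require Import all_boot all_order all_algebra.
From mathcomp Require Import all_classical all_reals all_analysis.
From mathcomp Require Import ring lra.

Import Order.TTheory GRing.Theory Num.Theory.
Import numFieldNormedType.Exports.

Local Open Scope classical_set_scope.
Local Open Scope ring_scope.

(** * Test sets bound total variation from below *)

Lemma tv_dist_ge (d : measure_display) (T : measurableType d) (R : realType)
    (P Q : probability T R) (A : set T) :
  measurable A ->
  ((`|fine (P A) - fine (Q A)|)%:E <= tv_dist P Q)%E.
Proof.
have tvB B : measurable B -> ((fine (P B) - fine (Q B))%:E <= tv_dist P Q)%E.
  move=> mB; rewrite EFinB !fineK ?fin_num_measure//.
  by apply: ereal_sup_ubound; exists B.
move=> mA; have [PQ|PQ] := lerP 0 (fine (P A) - fine (Q A)).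
  by rewrite ger0_norm//; exact: tvB.
(* The supremum runs over signed differences; passing to the complement flips the sign, as both
   masses are 1. *)
rewrite ltr0_norm//.
suff -> : - (fine (P A) - fine (Q A)) = fine (P (~` A)) - fine (Q (~` A)).
  exact/tvB/measurableC.
rewrite !probability_setC// !fineB ?fin_num_measure//=.
by ring.
Qed.

(** * Increments of the standard normal cdf *)

Definition std_normal_cdf (R : realType) (z : R) : R :=
  \int[lebesgue_measure]_(t in `]-oo, z]) normal_pdf 0 1 t.

Section std_normal_cdf.
Context {R : realType}.
Implicit Types m s x y z u v w b : R.
Local Notation G := (@std_normal_cdf R).
Local Notation pdf := (@normal_pdf R 0 1).

Lemma std_normal_pdfE x : pdf x = normal_peak 1 * expR (- x ^+ 2 / 2).
Proof. by rewrite normal_pdfE ?oner_neq0// /normal_fun subr0 expr1n. Qed.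

Lemma is_derive_std_normal_cdf z : is_derive z 1 G (pdf z).
Proof.
have xz : z < z + 1 by rewrite ltrDl.
have intG : lebesgue_measure.-integrable `]-oo, z + 1] (EFin \o pdf).
  by apply: (integrableS measurableT) => //; exact: integrable_normal_pdf.
have cpdf := @continuous_normal_pdf R 0 1 (oner_neq0 _) z.
have [|dG <-] := continuous_FTC1 xz intG _ cpdf; first by rewrite ltNyr.
by apply: DeriveDef => //; rewrite derive1E.
Qed.

Lemma normal_pdf_standardize m s z : 0 < s ->
  normal_pdf m s (z * s + m) * s = pdf z.
Proof.
move=> s0; have sN0 : s != 0 by rewrite gt_eqF.
rewrite std_normal_pdfE normal_pdfE// /normal_fun addrK.
have -> : - (z * s) ^+ 2 / (s ^+ 2 *+ 2) = - z ^+ 2 / 2 by field.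
rewrite /normal_peak expr1n mul1r -mulrnAr sqrtrM ?sqr_ge0// sqrtr_sqr gtr0_norm//.
by field; rewrite sN0 gt_eqF// sqrtr_gt0 mulrn_wgt0// pi_gt0.
Qed.

Lemma normal_prob_ray m s x : 0 < s ->
  normal_prob m s `]-oo, x] = (G ((x - m) / s))%:E.
Proof.
move=> s0; have sN0 : s != 0 by rewrite gt_eqF.
(* Affine substitution; its Jacobian [s] is absorbed by [normal_pdf_standardize]. *)
pose F z := z * s + m.
have dF z : is_derive (z : R) 1 F s.
  by rewrite /F; apply: is_derive_eq; rewrite addr0 scaler0 add0r /GRing.scale/= mulr1.
have F'E : (F^`())%classic = cst s.
  by apply/funext => z; rewrite derive1E; exact: derive_val.
have Fx : F ((x - m) / s) = x by rewrite /F divfK// subrK.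
rewrite /normal_prob -{1}Fx (@increasing_ge0_integration_by_substitutionNy _ F).
- rewrite /G /Rintegral fineK.
  + apply: eq_integral => z _; congr EFin; rewrite F'E.
    exact: normal_pdf_standardize.
  + apply: integrable_fin_num => //.
    by apply: (integrableS measurableT) => //; exact: integrable_normal_pdf.
- by move=> y z _ _ yz; rewrite /F ltrD2r ltr_pM2r.
- by rewrite F'E => ? _; exact: cvg_cst.
- by rewrite F'E; exact: is_cvg_cst.
- by rewrite F'E; exact: cvg_cst.
- split => [z _|].
    by have := dF z => -[].
  apply: cvg_at_left_filter; apply/differentiable_continuous.
  by rewrite -derivable1_diffP; have := dF ((x - m) / s) => -[].
- apply/cvgrNyPle => A.
  apply: filterS (nbhs_ninfty_le (num_real ((A - m) / s))) => z.
  by rewrite /F -lerBrDr -ler_pdivlMr.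
- apply: continuous_subspaceT; exact: continuous_normal_pdf.
- by move=> z _; exact: normal_pdf_ge0.
Qed.

Lemma std_normal_cdf_continuous : continuous G.
Proof.
move=> z; apply/differentiable_continuous; rewrite -derivable1_diffP.
by have [] := is_derive_std_normal_cdf z.
Qed.

Lemma std_normal_cdf_le x y : x <= y -> G x <= G y.
Proof.
move=> xy; have [|z _ Gxy] := MVT_segment xy (fun z _ => is_derive_std_normal_cdf z).
  exact/continuous_subspaceT/std_normal_cdf_continuous.
by rewrite -subr_ge0 Gxy mulr_ge0 ?normal_pdf_ge0// subr_ge0.
Qed.

(** The density is even, so [G z + G (- z)] has zero derivative. This moves right-tail increments to
    the left tail. *)
Lemma std_normal_cdf_symm x y : G y - G x = G (- x) - G (- y).
Proof.
pose H z := G z + G (- z).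
suff Hc z : H z = H 0 by have := Hc x; have := Hc y; rewrite /H; lra.
have dH t : is_derive (t : R) 1 H 0.
  have dN : is_derive (t : R) 1 (-%R : R -> R) (-1) by exact: is_deriveNid.
  have dGN := is_derive1_comp (is_derive_std_normal_cdf (- t)) dN.
  apply: is_derive_eq; first exact: is_deriveD (is_derive_std_normal_cdf t) dGN.
  by rewrite !std_normal_pdfE sqrrN mulrN1 subrr.
exact: is_derive_0_is_cst.
Qed.

Lemma std_normal_cdfB_ge x y : -2 <= x -> x <= y -> y <= 2 ->
  pdf 2 * (y - x) <= G y - G x.
Proof.
move=> x2 xy y2.
have [|z] := MVT_segment xy (fun z _ => is_derive_std_normal_cdf z).
  exact/continuous_subspaceT/std_normal_cdf_continuous.
rewrite in_itv/= => /andP[xz zy] ->.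
have : 0 <= (2 - z) * (2 + z) by rewrite mulr_ge0//; lra.
move=> z2.
rewrite ler_wpM2r ?subr_ge0// !std_normal_pdfE ler_wpM2l ?normal_peak_ge0//.
by rewrite ler_expR; lra.
Qed.

(** Cutting [u] off at 1 keeps the increment inside [[-2, -1]], where the density is at least
    [pdf 2]; this is the source of the minimum with 1. *)
Lemma std_normal_cdf_min_ge u : 0 <= u ->
  pdf 2 * Num.min 1 u <= G (-1) - G (-1 - u).
Proof.
move=> u0; set v := Num.min 1 u.
have v0 : 0 <= v by rewrite le_min ler01.
have v1 : v <= 1 by rewrite ge_min lexx.
have vu : v <= u by rewrite ge_min lexx orbT.
apply: (@le_trans _ _ (G (-1) - G (-1 - v))).
  have := @std_normal_cdfB_ge (-1 - v) (-1).
  have -> : -1 - (-1 - v) = v by ring.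
  by apply; lra.
by rewrite lerD2l lerN2 std_normal_cdf_le// lerD2l lerN2.
Qed.

(** For [z <= -1], [pdf (z - w) = pdf z * expR (z * w - w ^+ 2 / 2)] is at most
    [expR (- w) * pdf z], so [H] below is nondecreasing there. *)
Lemma std_normal_cdf_shift x y w : x <= y -> y <= -1 -> 0 <= w ->
  G (y - w) - G (x - w) <= expR (- w) * (G y - G x).
Proof.
move=> xy y1 w0.
pose H z := expR (- w) * G z - G (z - w).
have dH z : is_derive (z : R) 1 H (expR (- w) * pdf z - pdf (z - w)).
  have dS : is_derive (z : R) 1 (fun z => z - w) 1.
    by apply: is_derive_eq; rewrite subr0.
  have dGS := @is_derive1_comp _ G (fun z => z - w) _ _ _ (is_derive_std_normal_cdf (z - w)) dS.
  apply: is_derive_eq.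
    exact: is_deriveB (is_deriveZ (expR (- w)) (is_derive_std_normal_cdf z)) dGS.
  by rewrite mulr1.
have [|z] := MVT_segment xy (fun z _ => dH z).
  apply/continuous_subspaceT => z; apply/differentiable_continuous.
  by rewrite -derivable1_diffP; have [] := dH z.
rewrite in_itv/= => /andP[xz zy]; rewrite /H => E.
have : 0 <= (expR (- w) * pdf z - pdf (z - w)) * (y - x).
  rewrite mulr_ge0 ?subr_ge0// !std_normal_pdfE mulrCA ler_wpM2l ?normal_peak_ge0//.
  rewrite -expRD ler_expR.
  have : 0 <= w * (-1 - z) by rewrite mulr_ge0//; lra.
  have : 0 <= w ^+ 2 by exact: sqr_ge0.
  lra.
rewrite -E; lra.
Qed.

(** In units of the standard deviation, [u] and [v] are the displacements of the two means and [b]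
    is the outer gap. The second increment is that of [[-1 - v, -1]] shifted left by [b - v], and
    [b - v >= b / 2] because [2 * v <= u + v]. *)
Lemma std_normal_cdf_nested u v b : 0 <= v -> v <= u -> u + v <= b ->
  pdf 2 * (b / (2 + b)) * Num.min 1 u <=
  G (-1) - G (-1 - u) - (G (-1 - b + v) - G (-1 - b)).
Proof.
move=> v0 vu uvb.
have [] : 0 <= b - v /\ b / 2 <= b - v by split; lra.
move=> w0 wb.
have := @std_normal_cdf_shift (-1 - v) (-1) (b - v).
rewrite gerBl v0 lexx => /(_ isT isT w0).
rewrite [_ - (b - v)](_ : _ = -1 - b + v); last by ring.
rewrite [_ - v - (b - v)](_ : _ = -1 - b); last by ring.
have Guv : G (-1) - G (-1 - v) <= G (-1) - G (-1 - u).
  by rewrite lerD2l lerN2 std_normal_cdf_le// lerD2l lerN2.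
have Gv0 : 0 <= G (-1) - G (-1 - v).
  by rewrite subr_ge0 std_normal_cdf_le// gerBl.
have := @std_normal_cdf_min_ge u (le_trans v0 vu).
have b0 : 0 <= b by lra.
(* [1 + x <= expR x] turns the decay into a rational factor; its complement to 1 is
   [b / (2 + b)]. *)
have : expR (- (b - v)) <= 2 / (2 + b).
  rewrite expRN -[leRHS]invf_div lef_pV2 ?posrE ?expR_gt0 ?divr_gt0//; last by lra.
  by apply: le_trans (expR_ge1Dx _); lra.
have -> : b / (2 + b) = 1 - 2 / (2 + b) by field; lra.
have : 0 <= 2 / (2 + b) by rewrite divr_ge0//; lra.
have : 2 / (2 + b) <= 1 by rewrite ler_pdivrMr; lra.
set q := 2 / (2 + b); set e := expR _; set p := pdf 2; set mu := Num.min 1 u.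
have e0 : 0 <= e := expR_ge0 _.
nra.
Qed.

End std_normal_cdf.

(** * Total variation bounds for shifted and for nested means *)

Section normal_mixture_tv.
Context {R : realType}.
Implicit Types s a b x C : R.
Local Notation G := (@std_normal_cdf R).
Local Notation pdf := (@normal_pdf R 0 1).

Lemma normal_mixture_ray s a b x : 0 < s ->
  fine (normal_mixture s a b [set` `]-oo, x]]) = (G ((x - a) / s) + G ((x - b) / s)) / 2.
Proof.
move=> s0; rewrite (_ : normal_mixture s a b _ =
  (2^-1%:E * normal_prob a s `]-oo, x] + 2^-1%:E * normal_prob b s `]-oo, x])%E).
  by rewrite !normal_prob_ray//= -mulrDr mulrC.
exact: half_mixtureE.
Qed.

Lemma tv_normal_mixture_ge s a b a' b' x : 0 < s ->
  ((`|(G ((x - a) / s) - G ((x - a') / s)) -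
      (G ((x - b') / s) - G ((x - b) / s))| / 2)%:E
    <= tv_dist (normal_mixture s a b) (normal_mixture s a' b'))%E.
Proof.
move=> s0; set lhs := (X in X%:E).
suff -> : lhs = `|fine (normal_mixture s a b [set` `]-oo, x]]) -
                  fine (normal_mixture s a' b' [set` `]-oo, x]])|.
  exact: tv_dist_ge.
rewrite !normal_mixture_ray// /lhs -[X in _ / X](@ger0_norm _ 2)// -normf_div.
by congr `| _ |; field.
Qed.

Lemma tv_normal_mixture_shifted s a b a' b' : 0 < s -> a <= a' -> b <= b' ->
  ((pdf 2 / 2 * Num.min 1 (Num.max `|a' - a| `|b - b'| / s))%:E
    <= tv_dist (normal_mixture s a b) (normal_mixture s a' b'))%E.
Proof.
move=> s0 aa' bb'.
have sN0 : s != 0 by rewrite gt_eqF.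
have cdf_le x m m' : m <= m' -> G ((x - m') / s) <= G ((x - m) / s).
  move=> mm'; apply: std_normal_cdf_le.
  by rewrite ler_pM2r ?invr_gt0// lerD2l lerN2.
have cdf_ge m m' : m <= m' ->
    pdf 2 * Num.min 1 ((m' - m) / s) <=
    G ((m - s - m) / s) - G ((m - s - m') / s).
  move=> mm'; have mm0 : 0 <= (m' - m) / s.
    by rewrite divr_ge0 ?subr_ge0// ltW.
  have := std_normal_cdf_min_ge _ mm0.
  have -> : (m - s - m) / s = -1 by field.
  by have -> : (m - s - m') / s = -1 - (m' - m) / s by field.
rewrite ger0_norm ?subr_ge0// ler0_norm ?subr_le0// opprB.
(* Nothing cancels: the smaller displacement contributes with the right sign and is dropped. *)
have [ab|/ltW ab] := leP (b' - b) (a' - a).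
- apply: le_trans (tv_normal_mixture_ge s a b a' b' (a - s) s0).
  have := cdf_ge _ _ aa'; have := cdf_le (a - s) _ _ bb'.
  rewrite lee_fin mulrAC ler_pM2r// => h1 h2.
  by apply: le_trans (ler_norm _); lra.
- apply: le_trans (tv_normal_mixture_ge s a b a' b' (b - s) s0).
  have := cdf_ge _ _ bb'; have := cdf_le (b - s) _ _ aa'.
  rewrite lee_fin mulrAC ler_pM2r// => h1 h2.
  by apply: le_trans (ler_norm _); lra.
Qed.

(** The middle factor is of order [(b - a) / s] for a small gap and bounded below for a large one,
    so this bound serves (i) and the nested case of (ii). *)
Lemma tv_normal_mixture_nested s a b a' b' : 0 < s ->
  a <= a' -> a' <= b' -> b' <= b ->
  ((pdf 2 / 2 * ((b - a) / (2 * s + (b - a))) *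
      Num.min 1 (Num.max `|a' - a| `|b - b'| / s))%:E
    <= tv_dist (normal_mixture s a b) (normal_mixture s a' b'))%E.
Proof.
move=> s0 aa' ab' bb'.
have sN0 : s != 0 by rewrite gt_eqF.
pose d := (b - a) / s; pose u := (a' - a) / s; pose v := (b - b') / s.
have [u0 v0] : 0 <= u /\ 0 <= v by split; rewrite divr_ge0 ?subr_ge0// ltW.
have uvd : u + v <= d by rewrite /u /v /d -mulrDl ler_pM2r ?invr_gt0//; lra.
have -> : (b - a) / (2 * s + (b - a)) = d / (2 + d).
  by rewrite /d; field; rewrite sN0 gt_eqF//; lra.
rewrite ger0_norm ?subr_ge0// ger0_norm ?subr_ge0//.
have [uv|/ltW uv] := leP (b - b') (a' - a).
- have vu : v <= u by rewrite ler_pM2r ?invr_gt0.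
  apply: le_trans (tv_normal_mixture_ge s a b a' b' (a - s) s0).
  rewrite lee_fin mulrAC [pdf 2 / 2 * _]mulrAC [leLHS]mulrAC ler_pM2r//.
  have := std_normal_cdf_nested _ _ _ v0 vu uvd.
  have -> : (a - s - a) / s = -1 by field.
  have -> : (a - s - a') / s = -1 - u by rewrite /u; field.
  have -> : (a - s - b) / s = -1 - d by rewrite /d; field.
  have -> : (a - s - b') / s = -1 - d + v by rewrite /v /d; field.
  by rewrite -/u => h; apply: le_trans (ler_norm _); lra.
- have vu : u <= v by rewrite ler_pM2r ?invr_gt0.
  apply: le_trans (tv_normal_mixture_ge s a b a' b' (b + s) s0).
  rewrite lee_fin mulrAC [pdf 2 / 2 * _]mulrAC [leLHS]mulrAC ler_pM2r//.
  rewrite addrC in uvd.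
  have := std_normal_cdf_nested _ _ _ u0 vu uvd.
  have -> : (b + s - b) / s = 1 by field.
  have -> : (b + s - b') / s = 1 + v by rewrite /v; field.
  have -> : (b + s - a) / s = 1 + d by rewrite /d; field.
  have -> : (b + s - a') / s = 1 + d - u by rewrite /u /d; field.
  (* Reflection brings both brackets left of -1 with [u] and [v] exchanged. The signed difference is
     then negative, hence [normN_ge]. *)
  rewrite -/v (std_normal_cdf_symm (1 + d - u)) (std_normal_cdf_symm 1).
  rewrite !opprD !opprK => h.
  have normN_ge (z : R) : - z <= `|z| by rewrite -normrN ler_norm.
  apply: le_trans (normN_ge _). lra.
Qed.

End normal_mixture_tv.

(** * Choice of the constant and assembly of the cases *)

Theorem theorem2 (R : realType) (C : R) (hC : 0 < C) :
  exists2 c : R, 0 < c &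
    forall (s m0 m1 m0' m1' : R),
      0 < s ->
      m0 <= Num.min m1 (Num.min m0' m1') ->
      m0' <= m1' ->
      let delta1 := Num.max `|m0 - m1| `|m0' - m1'| in
      let delta2 := Num.max `|m0' - m0| `|m1 - m1'| in
      let TV := tv_dist (normal_mixture s m0 m1) (normal_mixture s m0' m1') in
      let nested_close :=
        [set` `[m0', m1']] `<=` [set` `[m0, m1]] /\ C * delta1 <= s in
      (nested_close ->
        ((c * Num.min 1 (delta1 * delta2 / s ^+ 2))%:E <= TV)%E) /\
      (~ nested_close ->
        ((c * Num.min 1 (delta2 / s))%:E <= TV)%E).
Proof.
pose k : R := normal_pdf 0 1 2 / 2.
have k0 : 0 < k.
  by rewrite divr_gt0// std_normal_pdfE mulr_gt0 ?expR_gt0// normal_peak_gt0// oner_neq0.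
(* [q] lies below 1 (shifted case), [C / (1 + 2 * C)] (nested, [C * d1 <= s]) and [1 / (1 + 2 * C)]
   (nested, [s < C * d1]). *)
pose q := C / ((1 + C) * (1 + 2 * C)).
have q0 : 0 < q by rewrite divr_gt0// mulr_gt0; lra.
have C12 : 0 < (1 + C) * (1 + 2 * C) by rewrite mulr_gt0; lra.
have q1 : q <= 1 by rewrite ler_pdivrMr//; nra.
exists (k * q); first by rewrite mulr_gt0.
move=> s a b a' b' s0; rewrite !le_min => /and3P[ab aa' _] ab' d1 d2 TV nc.
have d1ge0 : 0 <= d1 by rewrite le_max normr_ge0.
have d2ge0 : 0 <= d2 by rewrite le_max normr_ge0.
have mge0 : 0 <= Num.min 1 (d2 / s) by rewrite le_min ler01 divr_ge0// ltW.
(* Since [a <= a'] and [a' <= b'], nestedness amounts to [b' <= b]; otherwise (i) is vacuous. *)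
have [b'b|bb'] := leP b' b; last first.
  have shifted : ((k * q * Num.min 1 (d2 / s))%:E <= TV)%E.
    apply: le_trans (tv_normal_mixture_shifted _ _ _ _ _ s0 aa' (ltW bb')).
    by rewrite lee_fin -/d2 -/k ler_wpM2r// ler_piMr// ltW.
  split=> // -[sub _].
  have := sub b'; rewrite /= !in_itv/= lexx ab' => /(_ isT) /andP[_].
  by rewrite leNgt bb'.
have d1E : d1 = b - a.
  rewrite /d1 distrC (@ger0_norm _ (b - a)) ?subr_ge0// ler0_norm ?subr_le0//.
  by apply: max_l; lra.
have nested := tv_normal_mixture_nested _ _ _ _ _ s0 aa' ab' b'b.
rewrite -/d2 -/TV -/k -d1E in nested.
split=> [[_ Cd1]|Nnc].
  apply: le_trans nested; rewrite lee_fin -!(mulrA k) ler_pM2l//.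
  have d21 : d2 <= d1.
    by rewrite d1E ge_max !ger0_norm ?subr_ge0//; apply/andP; split; lra.
  have -> : d1 * d2 / s ^+ 2 = (d1 / s) * (d2 / s) by field; rewrite gt_eqF.
  have -> : d1 / (2 * s + d1) = (d1 / s) / (2 + d1 / s).
    by field; rewrite !gt_eqF//; lra.
  have rt : d2 / s <= d1 / s by rewrite ler_pM2r// invr_gt0.
  have t0 : 0 <= d1 / s by rewrite divr_ge0// ltW.
  have Ct : C * (d1 / s) <= 1 by rewrite mulrA ler_pdivrMr// mul1r.
  move: (d1 / s) (d2 / s) mge0 rt t0 Ct => t r mge0 rt t0 Ct.
  (* This rests on [r <= t]: if [1 < r], the right side is [t], which exceeds 1. *)
  have minM : Num.min 1 (t * r) <= t * Num.min 1 r.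
    rewrite ge_min; have [r1|r1] := leP r 1; first by rewrite lexx orbT.
    by rewrite mulr1 (le_trans (ltW r1) rt).
  apply: (@le_trans _ _ (q * t * Num.min 1 r)).
    by rewrite -mulrA ler_pM2l.
  rewrite ler_wpM2r// ler_pdivlMr; last by lra.
  rewrite mulrAC ler_piMl// /q mulrAC ler_pdivrMr//.
  by nra.
(* The means are nested here, so only the scale condition can fail. *)
have Cd1 : s < C * d1.
  rewrite ltNge; apply/negP => Cd1; apply: Nnc; split=> //.
  by apply: subset_itv; rewrite bnd_simp.
apply: le_trans nested; rewrite lee_fin ler_wpM2r// ler_pM2l//.
rewrite ler_pdivlMr; last by lra.
rewrite /q mulrAC ler_pdivrMr//.
have : 0 <= (C * d1 - s) * C by rewrite mulr_ge0//; lra.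
by nra.
Qed.
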